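(* Let $\varphi\in[0,\pi/2]$, let $I\subseteq\mathbb{R}$ be an open set which is $\varphi$-invex with respect to $\eta:I\times I\to\mathbb{R}$, and let $a,b\in I$ with $\eta(b,a)>0$. Let $f:I\to\mathbb{R}$ be twice differentiable with $f''\in L_1[a,a+e^{i\varphi}\eta(b,a)]$, and let $\alpha>0$. Suppose $|f''|$ is $h_\varphi$-preinvex on $I$ (with respect to $\varphi$ and $\eta$). Put $c=e^{i\varphi}\eta(b,a)$. Then $$\left|f(a)+f(a+c)-\frac{\Gamma(\alpha+1)}{c^{\alpha}}\left\{J_{a^+}^{\alpha}f(a+c)+J_{(a+c)^-}^{\alpha}f(a)\right\}\right|\le c^{2}\left\{\bigl(|f''(a)|+|f''(b)|\bigr)\int_0^1\left[\frac{1-(1-t)^{\alpha+1}-t^{\alpha+1}}{\alpha+1}\right]h(t)\,dt\right\} .$$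
   Context: A set $I\subseteq\mathbb{R}$ is $\varphi$-invex with respect to $\eta:I\times I\to\mathbb{R}$ if $u+te^{i\varphi}\eta(v,u)\in I$ for all $u,v\in I$, $t\in[0,1]$; here $\varphi\in[0,\pi/2]$ is fixed. In particular, since $I\subseteq\mathbb{R}$, the number $e^{i\varphi}\eta(b,a)$ is real. Let $h:J\to\mathbb{R}$ be a nonnegative function, $[0,1]\subseteq J\subseteq\mathbb{R}$, for which the integral on the right-hand side exists as a finite Lebesgue integral. A function $g:I\to\mathbb{R}$ is $h_\varphi$-preinvex (with respect to $\varphi,\eta$) if $g(u+te^{i\varphi}\eta(v,u))\le h(1-t)g(u)+h(t)g(v)$ for all $u,v\in I$, $t\in[0,1]$. Riemann–Liouville fractional integrals of order $\alpha>0$: $J_{r^+}^{\alpha}f(x)=\frac{1}{\Gamma(\alpha)}\int_r^x(x-t)^{\alpha-1}f(t)\,dt$ for $x>r$, and $J_{r^-}^{\alpha}f(x)=\frac{1}{\Gamma(\alpha)}\int_x^r(t-x)^{\alpha-1}f(t)\,dt$ for $x<r$. *)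

(* Defs.v *)
From mathcomp Require Import all_boot all_order all_algebra.
From mathcomp Require Import complex.
From mathcomp Require Import all_classical all_reals all_analysis.
Import Order.TTheory GRing.Theory Num.Theory.
Import numFieldNormedType.Exports.

Set Implicit Arguments.
Unset Strict Implicit.
Unset Printing Implicit Defensive.

Local Open Scope classical_set_scope.
Local Open Scope complex_scope.
Local Open Scope ring_scope.

(* exp(i phi), as a complex number. *)
Definition expi (R : realType) (phi : R) : R[i] := cos phi +i* sin phi.

(* u + t exp(i phi) eta(v, u); a priori not a real number. *)
Definition phi_point (R : realType) (phi : R) (eta : R -> R -> R)
    (u v t : R) : R[i] :=
  u%:C + t%:C * expi phi * (eta v u)%:C.

(* Functions on I (and eta on I x I) are represented by total functions, of
   which only the values on I matter. Membership of phi_point in I, a subset of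
   the real line, in particular says that phi_point is a real number. *)
Definition phi_invex (R : realType) (phi : R) (eta : R -> R -> R)
    (I : set R) : Prop :=
  forall u v t : R, I u -> I v -> t \in `[0, 1] ->
    [set x%:C | x in I] (phi_point phi eta u v t).

(* w is the real number u + t exp(i phi) eta(v, u), which exists and is in I
   when I is phi-invex. *)
Definition h_phi_preinvex (R : realType) (h : R -> R) (phi : R)
    (eta : R -> R -> R) (I : set R) (g : R -> R) : Prop :=
  forall u v t w : R, I u -> I v -> t \in `[0, 1] -> I w ->
    w%:C = phi_point phi eta u v t ->
    g w <= h (1 - t) * g u + h t * g v.

(* Euler's integral, meaningful for 0 < alpha. *)
Definition Gamma (R : realType) (alpha : R) : R :=
  \int[lebesgue_measure]_(x in `]0, +oo[) (x `^ (alpha - 1) * expR (- x)).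

(* J_{r^+}^alpha f (x), meaningful for r < x. The singular endpoint, where powR
   takes a conventional value, is negligible. *)
Definition RL_right (R : realType) (alpha r : R) (f : R -> R) (x : R) : R :=
  (Gamma alpha)^-1 *
  \int[lebesgue_measure]_(t in `[r, x]) ((x - t) `^ (alpha - 1) * f t).

(* J_{r^-}^alpha f (x), meaningful for x < r. *)
Definition RL_left (R : realType) (alpha r : R) (f : R -> R) (x : R) : R :=
  (Gamma alpha)^-1 *
  \int[lebesgue_measure]_(t in `[x, r]) ((t - x) `^ (alpha - 1) * f t).

(* Main.v *)
(* The angle is forced to be 0, since exp(i phi) eta(b, a) is real and
   phi lies in [0, pi / 2].  The kernel Q vanishes at both ends of [a, a + c],
   Q' = - P with P(a) = -1 and P(a + c) = 1, so that (Q f' + P f)' = Q f'' + P' f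
   and integration over [a, a + c] gives
     f(a) + f(a + c) = \int Q f'' + \int P' f,
   where \int P' f is the fractional term because Gamma(alpha + 1) =
   alpha Gamma(alpha). Bounding |f''| by preinvexity and rescaling to [0, 1]
   concludes.

   Since f'' is only assumed integrable, this needs the fundamental theorem for
   a derivative that exists everywhere and is in L1. It is proved by comparing G
   with the integral of max(G', -n): off a null set N the latter has derivative
   at least G' by Lebesgue differentiation, and on N one adds a small
   nondecreasing function with infinite derivative. *)
Require Import Defs.
From mathcomp Require Import all_boot all_order all_algebra.
From mathcomp Require Import complex ring lra.
From mathcomp Require Import all_classical all_reals all_analysis.
From mathcomp Require Import measurable_realfun.
Import Order.TTheory GRing.Theory Num.Theory.
Import numFieldNormedType.Exports.

Local Open Scope classical_set_scope.
Local Open Scope complex_scope.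
Local Open Scope ring_scope.

Set Implicit Arguments.
Unset Strict Implicit.
Unset Printing Implicit Defensive.

(** * Fundamental theorem of calculus for an integrable derivative *)

Lemma within_continuous_cvg_at_left (R : realType) (C : R -> R) (u v x : R) :
  {within `[u, v], continuous C} -> u < x -> x <= v ->
  C y @[y --> x^'-] --> C x.
Proof.
move=> cC ux; have uv := lt_le_trans ux; rewrite le_eqVlt => /predU1P[xv|xv].
  have uv' : u < v by rewrite -xv.
  by move: cC => /(continuous_within_itvP _ uv')[_ _]; rewrite xv.
have uv' : u < v by exact: lt_trans xv.
move: cC => /(continuous_within_itvP _ uv')[+ _ _] => /(_ x).
rewrite in_itv/= ux xv => /(_ isT) cx.
exact/cvg_at_left_filter/cx.
Qed.

(** Supremum argument, started at some u' > u with slack e: the points y where C y + M y + e (y -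
    u') has not dropped below its value at u' reach up to v. Then e tends to 0 and u' to u. [M] may
    jump, but only upward, which does no harm. *)
Lemma nondecreasing_of_right_derivate (R : realType) (C M : R -> R) (u v : R) :
  u < v -> {within `[u, v], continuous C} -> {homo M : x y / x <= y} ->
  (forall x e : R, u < x < v -> 0 < e ->
    \forall y \near x^'+, C x + M x <= C y + M y + e * (y - x)) ->
  C u + M u <= C v + M v.
Proof.
move=> uv cC ndM DCM.
have step (u' e : R) : u < u' < v -> 0 < e ->
    C u' + M u' <= C v + M v + e * (v - u').
  move=> /andP[uu' u'v] e0.
  pose D y := C y + M y + e * (y - u').
  have DE : D u' = C u' + M u' by rewrite /D subrr mulr0 addr0.
  rewrite -DE -/(D v).
  pose S := [set y | u' <= y <= v /\ D u' <= D y].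
  have Su' : S u' by split; rewrite // lexx ltW.
  have ubS : ubound S v by move=> y [/andP[]].
  have hS : has_sup S by split; [exists u'|exists v].
  have u's : u' <= sup S by apply: ub_le_sup => //; exists v.
  have sv : sup S <= v by apply: ge_sup => //; exists u'.
  (* The supremum belongs to [S]: close to it on the left [C] varies by less than [d / 2], and the
     other two terms of [D] can only increase. *)
  have Ss : D u' <= D (sup S).
    move: u's; rewrite le_eqVlt => /predU1P[<-//|u's].
    rewrite leNgt; apply/negP => Ds.
    pose d := D u' - D (sup S).
    have d0 : 0 < d / 2 by rewrite divr_gt0// subr_gt0.
    have /cvgrPdist_lt/(_ _ d0) cl :=
      within_continuous_cvg_at_left cC (lt_trans uu' u's) sv.
    have [r /= r0 nearr] : exists2 r : R, 0 < r &
        forall y, sup S - r < y -> y < sup S ->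
          `|C (sup S) - C y| < d / 2.
      move: cl; rewrite near_withinE => -[r /= r0 H]; exists r => // y y1 y2.
      by apply: H => //=; rewrite ger0_norm; lra.
    have [y [/andP[u'y yv] Dy] sy] := sup_adherent r0 hS.
    have ys : y <= sup S by apply: ub_le_sup; [exists v|split => //; apply/andP].
    move: ys; rewrite le_eqVlt => /predU1P[ys|ys].
      by move: Dy; rewrite ys; lra.
    have := nearr _ sy ys; rewrite ltr_norml => /andP[h1 h2].
    have My := ndM _ _ (ltW ys).
    have ey : e * (y - u') <= e * (sup S - u').
      by rewrite ler_wpM2l// ?lerD2r ltW.
    move: Ds Dy h1; rewrite /d /D; lra.
  (* If [sup S < v], the hypothesis at [sup S] produces points of [S] beyond it. *)
  move: sv; rewrite le_eqVlt => /predU1P[<-//|sv].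
  exfalso.
  have us : u < sup S < v by rewrite sv (lt_le_trans uu').
  have /= Hn := DCM _ _ us e0.
  near (sup S)^'+ => y.
  have sy : sup S < y by near: y; exact: nbhs_right_gt.
  have yv : y <= v by near: y; exact: nbhs_right_le.
  have Sy : S y.
    split; first by rewrite yv (le_trans u's (ltW sy)).
    apply: (le_trans Ss).
    have : C (sup S) + M (sup S) <= C y + M y + e * (y - sup S) by near: y.
    rewrite /D; lra.
  by have := ub_le_sup (ex_intro _ v ubS) Sy; rewrite leNgt sy.
have step2 u' : u < u' < v -> C u' + M u' <= C v + M v.
  move=> uu'v; apply/ler_addgt0Pl => e e0.
  have /andP[uu' u'v] := uu'v.
  have vu' : 0 < v - u' by rewrite subr_gt0.
  have := step u' (e / (v - u')) uu'v (divr_gt0 e0 vu').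
  by rewrite divfK ?gt_eqF// (addrC e).
(* To let u' tend to u, right continuity of [C] at [u] is combined with [M u <= M u']. *)
have [_ cu _] := (continuous_within_itvP C uv).1 cC.
apply/ler_addgt0Pl => e e0.
move/cvgrPdist_lt : cu => /(_ _ e0) cu.
near u^'+ => u'.
have uu' : u < u' by near: u'; exact: nbhs_right_gt.
have u'v : u' < v by near: u'; exact: nbhs_right_lt.
have : `|C u - C u'| < e by near: u'.
have := step2 u'; rewrite uu' u'v => /(_ isT).
have := ndM _ _ (ltW uu').
rewrite ltr_norml => h1 h2 /andP[h3 h4]; lra.
Unshelve. all: by end_near. Qed.

Lemma null_set_gauge (R : realType) (N : set R) (eps : R) :
  (@lebesgue_measure R).-negligible N -> 0 < eps ->
  exists M : R -> R, [/\ {homo M : x y / x <= y}, (forall x, 0 <= M x <= eps) &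
    forall x K : R, N x -> \forall y \near x^'+, K * (y - x) <= M y - M x].
Proof.
move=> /negligible_outer_measure N0 eps0.
(* These bounds on the measures of the [U n] sum to [eps], which then bounds the total mass of
   [m]. *)
have en0 n : 0 < eps / (2 ^ n.+1)%:R by rewrite divr_gt0// ltr0n expn_gt0.
have /choice[U UP] n := outer_measure_open_le N (en0 n).
have oU n : open (U n) by have [] := UP n.
have NU n : N `<=` U n by have [] := UP n.
have mU n : measurable (U n) by exact: open_measurable.
(* [M x] is the mass of [`]-oo, x]] for the sum [m] of the restrictions of the
   Lebesgue measure to neighbourhoods [U n] of [N] of summable measures: near [x]
   in [N], [m] is at least [k] times the Lebesgue measure for every [k]. *)
pose m : {measure set (measurableTypeR R) -> \bar R} :=
  mseries (fun n => mrestr (@lebesgue_measure R) (mU n)) 0.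
have mE A : m A = (\sum_(0 <= n <oo) lebesgue_measure (A `&` U n))%E by [].
have meps A : measurable A -> (m A <= eps%:E)%E.
  move=> mA; rewrite mE.
  apply: le_trans (epsilon_trick0 xpredT (ltW eps0)).
  apply: lee_nneseries => // n _.
  have [_ _] := UP n; rewrite N0 add0e; apply: le_trans.
  by apply: le_measure; [apply/mem_set; exact: (measurableI _ _ mA (mU n))
    |apply/mem_set; exact: mU|exact: subIsetr].
have fm A : measurable A -> m A \is a fin_num.
  by move=> mA; rewrite ge0_fin_numE// (le_lt_trans (meps _ mA))// ltry.
exists (fun x => fine (m `]-oo, x]%classic)); split.
- move=> x y xy; apply: fine_le; rewrite ?fm//.
  by apply: le_measure; [exact/mem_set|exact/mem_set|apply: subset_itvl; rewrite bnd_simp].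
- move=> x; rewrite fine_ge0//= -lee_fin fineK ?fm//; exact: meps.
- move=> x K Nx.
  pose k := (Num.trunc K).+1.
  have Kk : K < k%:R := truncnS_gt K.
  have : \forall z \near x, forall i : 'I_k, U i z.
    have FF : Filter (nbhs x) by exact: nbhs_filter.
    apply: (@filter_forall _ 'I_k (fun i z => U i z) _ FF) => i.
    apply: open_nbhs_nbhs; split => //; exact: NU.
  move=> [r /= r0 xrU].
  near=> y.
  have xy : x < y by near: y; exact: nbhs_right_gt.
  have yxr : y < x + r by near: y; apply: nbhs_right_lt; rewrite ltrDl.
  have subU (i : 'I_k) : `]x, y] `<=` U i.
    move=> z /=; rewrite in_itv/= => /andP[xz zy]; apply: xrU => /=.
    by rewrite ltr0_norm; lra.
  have mxy : ((k%:R * (y - x))%:E <= m `]x, y]%classic)%E.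
    rewrite mE; apply: le_trans (nneseries_lim_ge k _) => //.
    rewrite big_mkord (eq_bigr (fun=> (y - x)%:E)); last first.
      move=> i _; rewrite (setIidl (subU i)).
      by rewrite lebesgue_measure_itv/= lte_fin xy EFinB.
    by rewrite sumEFin sumr_const card_ord mulr_natl.
  have -> : (`]-oo, y] = `]-oo, x] `|` `]x, y])%classic.
    by rewrite -itv_bndbnd_setU// bnd_simp// ltW.
  rewrite measureU//; last first.
    by apply/seteqP; split => // z [] /=; rewrite !in_itv/= => zx; rewrite ltNge zx.
  rewrite fineD ?fm// addrAC subrr add0r.
  apply: (@le_trans _ _ (k%:R * (y - x))).
    by rewrite ler_wpM2r ?subr_ge0 ?ltW.
  by rewrite -lee_fin fineK ?fm.
Unshelve. all: by end_near. Qed.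

Lemma integrable_itv_cst (R : realType) (a b k : R) (b0 b1 : bool) :
  (@lebesgue_measure R).-integrable [set` Interval (BSide b0 a) (BSide b1 b)]
    (EFin \o cst k).
Proof.
apply: measurable_bounded_integrable => //=; last exact: bounded_cst.
by rewrite lebesgue_measure_itv/=; case: ifPn => // _; rewrite -EFinB ltry.
Qed.

Lemma is_derive_near_right (R : realType) (F : R -> R) (x l e : R) :
  is_derive x 1 F l -> 0 < e ->
  \forall y \near x^'+, `|F y - F x - l * (y - x)| <= e * (y - x).
Proof.
move=> [dF lE] e0.
move/cvg_ex : (dF) => [l' Fl'].
have {lE} ll' : l' = l by rewrite -lE; apply/esym/cvg_lim.
move: Fl'; rewrite {}ll' => /cvgrPdist_lt/(_ _ e0) [r /= r0 H].
near=> y.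
have xy : x < y by near: y; exact: nbhs_right_gt.
have yxr : y < x + r by near: y; apply: nbhs_right_lt; rewrite ltrDl.
have := H (y - x); rewrite /= sub0r normrN gtr0_norm ?subr_gt0//.
have -> : (y - x < r)%R = true by apply/idP; lra.
rewrite subr_eq0 gt_eqF// => /(_ isT isT).
rewrite /GRing.scale/= mulr1 subrK => /ltW.
have yx0 : 0 < y - x by rewrite subr_gt0.
rewrite -(ler_pM2r yx0) -{2}(gtr0_norm yx0) -normrM.
by rewrite mulrBl mulrAC mulVf ?gt_eqF// mul1r distrC.
Unshelve. all: by end_near. Qed.

(** The right-derivate criterion is applied to [Phi - G], with [Phi] the integral of [m]; the
    monotone term is the gauge of the exceptional null set, whose total rise is at most [eps]. *)
Lemma FTC_le_truncated (R : realType) (G g m : R -> R) (u v k : R) :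
  u < v -> {within `[u, v], continuous G} ->
  (forall x : R, x \in `]u, v[ -> is_derive x 1 G (g x)) ->
  (@lebesgue_measure R).-integrable `[u, v] (EFin \o m) ->
  (forall x, x \in `[u, v] -> g x <= m x /\ k <= m x) ->
  G v - G u <= \int[lebesgue_measure]_(x in `[u, v]) m x.
Proof.
move=> uv cG dG im gm.
pose mu := @lebesgue_measure R.
(* Extension by zero makes [m] integrable on the whole line, as the differentiation theorem [FTC1]
   asks. *)
pose m' := m \_ `[u, v].
have im' A : measurable A -> mu.-integrable A (EFin \o m').
  move=> mA; apply: (@integrableS _ _ _ _ setT) => //.
  by rewrite /m' -restrict_EFin; apply/integrable_restrict => //; rewrite setTI.
have locm' : locally_integrable setT m' by exact: integrable_locally.
pose Phi x := \int[mu]_(t in `[u, x]) m' t.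
have := @FTC1 R m' (BLeft u) (fun y => im' _ (measurable_itv _)) locm'.
pose Q x := u < x -> derivable Phi x 1 /\ Phi^`()%classic x = m' x.
move=> aeQ; have {}aeQ : mu.-negligible (~` Q) by exact: aeQ.
apply/ler_addgt0Pr => eps eps0.
have [M [ndM M01 dM]] := null_set_gauge aeQ eps0.
have iuv : mu.-integrable `[u, v] (EFin \o m') by exact: im'.
have cPhi : {within `[u, v], continuous Phi}.
  exact: parameterized_integral_continuous (ltW uv) iuv.
have cC : {within `[u, v], continuous (fun x => Phi x - G x)}.
  by move=> x; apply: cvgB; [exact: cPhi|exact: cG].
have := nondecreasing_of_right_derivate uv cC ndM.
have Phiu : Phi u = 0 by rewrite /Phi set_itv1 Rintegral_set1.
have -> : \int[mu]_(x in `[u, v]) m x = Phi v.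
  by apply: eq_Rintegral => x xuv; rewrite /m' patchE xuv.
rewrite Phiu => h; have {h} : 0 - G u + M u <= Phi v - G v + M v.
  apply: h => x e /andP[ux xv] e0.
  have xuv : x \in `]u, v[ by rewrite in_itv/= ux.
  have e20 : 0 < e / 2 by rewrite divr_gt0.
  have [gx kx] : g x <= m x /\ k <= m x.
    by apply: gm; rewrite in_itv/= !ltW.
  (* off the null set [~` Q], [Phi] has derivative [m x]; on it, only the bound
     [k <= m] is available and [M] makes up for the difference *)
  have [Qx|nQx] := pselect (Q x).
    have [dPhi Phix] : derivable Phi x 1 /\ Phi^`()%classic x = m' x.
      exact: Qx.
    have Phix' : is_derive x 1 Phi (m x).
      split => //; rewrite -derive1E Phix /m' patchE mem_set//=.
      by rewrite in_itv/= !ltW.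
    have nPhi := is_derive_near_right Phix' e20.
    have nG := is_derive_near_right (dG _ xuv) e20.
    near=> y.
    have xy : x < y by near: y; exact: nbhs_right_gt.
    have := ndM _ _ (ltW xy).
    have : `|Phi y - Phi x - m x * (y - x)| <= e / 2 * (y - x) by near: y.
    have : `|G y - G x - g x * (y - x)| <= e / 2 * (y - x) by near: y.
    have : g x * (y - x) <= m x * (y - x).
      by rewrite ler_wpM2r// subr_ge0 ltW.
    by rewrite !ler_norml => h1 /andP[h2 h3] /andP[h4 h5] h6; lra.
  have nM := dM x (g x - k) nQx.
  have nG := is_derive_near_right (dG _ xuv) e0.
  near=> y.
  have xy : x < y by near: y; exact: nbhs_right_gt.
  have yv : y < v by near: y; exact: nbhs_right_lt.
  have : (g x - k) * (y - x) <= M y - M x by near: y.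
  have : `|G y - G x - g x * (y - x)| <= e * (y - x) by near: y.
  have : k * (y - x) <= Phi y - Phi x.
    rewrite /Phi Rintegral_itvB; [|exact: im'|by rewrite bnd_simp ltW..].
    have -> : k * (y - x) = \int[mu]_(t in `]x, y]) k.
      rewrite Rintegral_cst//; congr (_ * _).
      have := @lebesgue_measure_itv R `]x, y].
      by rewrite /= lte_fin xy => ->.
    apply: le_Rintegral => //; last 2 first.
      - exact: im'.
      - move=> t /=; rewrite in_itv/= => /andP[xt ty].
        have tuv : t \in `[u, v] by rewrite in_itv/=; apply/andP; split; lra.
        by rewrite /m' patchE mem_set//; apply: (gm t tuv).2.
    exact: integrable_itv_cst.
  rewrite !ler_norml => h1 /andP[h2 h3] h4; lra.
have /andP[? _] := M01 u; have /andP[_ ?] := M01 v; lra.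
Unshelve. all: by end_near. Qed.

(** The truncations max(g, -n) are bounded below and dominated by |g|, so dominated convergence
    carries the bound for each of them to the limit. *)
Lemma FTC_le (R : realType) (G g : R -> R) (u v : R) :
  u < v -> {within `[u, v], continuous G} ->
  (forall x : R, x \in `]u, v[ -> is_derive x 1 G (g x)) ->
  (@lebesgue_measure R).-integrable `[u, v] (EFin \o g) ->
  G v - G u <= \int[lebesgue_measure]_(x in `[u, v]) g x.
Proof.
move=> uv cG dG ig.
pose mu := @lebesgue_measure R.
pose m (n : nat) (x : R) := Num.max (g x) (- n%:R).
have mg : measurable_fun `[u, v] g.
  by apply/measurable_EFinP; exact: (measurable_int mu).
have mm n : measurable_fun `[u, v] (m n).
  by apply: measurable_maxr => //; exact: measurable_cst.
have mabs n x : `|m n x| <= `|g x|.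
  rewrite /m; have [gn|//] := ltP (g x) (- n%:R).
  have g0 : g x <= 0 by apply: le_trans (ltW gn) _; rewrite oppr_le0.
  by rewrite normrN ger0_norm// ler0_norm// lerNr ltW.
have im n : mu.-integrable `[u, v] (EFin \o m n).
  apply: (le_integrable _ _ _ ig) => //; first by apply/measurable_EFinP; exact: mm.
  by move=> x _; rewrite /= lee_fin mabs.
have le n : ((G v - G u)%:E <= \int[mu]_(x in `[u, v]) (m n x)%:E)%E.
  rewrite -[leRHS]fineK; last exact: integrable_fin_num (im n).
  rewrite lee_fin; apply: (FTC_le_truncated (k := - n%:R) uv cG dG (im n)).
  by move=> x _; rewrite /m !le_max !lexx orbT.
rewrite -lee_fin [leRHS]fineK; last exact: integrable_fin_num ig.
have cvgm : (\int[mu]_(x in `[u, v]) (m n x)%:E)%E @[n --> \oo] -->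
    (\int[mu]_(x in `[u, v]) (g x)%:E)%E.
  apply: (@dominated_cvg _ _ _ mu _ _ _ _ (fun x => `|g x|%:E)) => //.
  - by move=> n; apply/measurable_EFinP; exact: mm.
  (* At a fixed x the sequence is constant once n >= - g x. *)
  - move=> x _; apply: cvg_near_cst; near=> n; congr EFin.
    apply/max_idPl; rewrite lerNl; near: n.
    exact: nbhs_infty_ger.
  - exact: integrable_norm.
  - by move=> n x _; rewrite lee_fin mabs.
rewrite -(cvg_lim _ cvgm)//; apply: lime_ge; first by apply/cvg_ex; eexists; exact: cvgm.
exact: nearW.
Unshelve. all: by end_near. Qed.

(** [FTC_le] for [G] and for [- G] gives the two inequalities. *)
Lemma Rintegral_derive (R : realType) (G g : R -> R) (u v : R) :
  u < v -> {within `[u, v], continuous G} ->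
  (forall x : R, x \in `]u, v[ -> is_derive x 1 G (g x)) ->
  (@lebesgue_measure R).-integrable `[u, v] (EFin \o g) ->
  \int[lebesgue_measure]_(x in `[u, v]) g x = G v - G u.
Proof.
move=> uv cG dG ig; apply/eqP; rewrite eq_le; apply/andP; split; last exact: FTC_le.
have cNG : {within `[u, v], continuous (- G)}.
  by move=> x; apply: cvgN; exact: cG.
have dNG (x : R) : x \in `]u, v[ -> is_derive x 1 (- G) (- g x).
  by move=> /dG ?; exact: is_deriveN.
have igN : (@lebesgue_measure R).-integrable `[u, v] (EFin \o (- g)).
  apply: eq_integrable (integrableN ig) => // x _; exact: EFinN.
have := FTC_le uv cNG dNG igN.
have -> : \int[lebesgue_measure]_(x in `[u, v]) (- g) x =
    \int[lebesgue_measure]_(x in `[u, v]) (-1 * g x).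
  by apply: eq_Rintegral => x _; rewrite mulN1r.
rewrite RintegralZl// mulN1r !fctE opprK; lra.
Qed.

(** * Real powers: growth, continuity, integrability near 0 *)

Lemma powR_le_expR (R : realType) (p : R) : 0 < p ->
  exists2 C : R, 0 < C & forall x, 0 < x -> x `^ p <= C * expR (x / 2).
Proof.
(* This constant is the maximum of x^p exp(-x/2) over x > 0, attained at x = 2p. *)
move=> p0; exists (expR (p * ln (2 * p) - p)); first exact: expR_gt0.
move=> x x0; have p20 : 0 < 2 * p by rewrite mulr_gt0.
rewrite /powR gt_eqF// -expRD ler_expR.
(* [ln y <= y - 1] at [y = x / (2 p)] *)
have : ln (1 + (x / (2 * p) - 1)) <= x / (2 * p) - 1.
  by apply: le_ln1Dx; rewrite ltrBDl subrr divr_gt0.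
rewrite addrC subrK ln_div ?posrE// => /(ler_wpM2l (ltW p0)).
rewrite !mulrBr mulr1 => h.
have e : p * (x / (2 * p)) = x / 2 by field; rewrite gt_eqF.
rewrite e in h; lra.
Qed.

(** The absolute value hides the default value of [powR] at negative arguments, which would spoil
    continuity at 0. At 0 itself, |y| < e^(1/p) forces |y|^p < e. *)
Lemma continuous_normr_powR (R : realType) (p : R) : 0 < p ->
  continuous (fun x : R => `|x| `^ p).
Proof.
move=> p0 x; have [->|x0] := eqVneq x 0; last first.
  apply: (@continuous_comp _ _ _ (fun x : R => `|x|) (@powR R ^~ p)).
    exact: norm_continuous.
  apply: differentiable_continuous; apply/derivable1_diffP.
  by apply: derivable_powR; rewrite in_itv/= andbT normr_gt0.
apply/cvgrPdist_lt => e e0.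
have e1 : 0 < e `^ p^-1 by rewrite powR_gt0.
near=> y.
have ye : `|y| < e `^ p^-1.
  by near: y; exact: (cvgr0_norm_lt id).
rewrite normr0 powR0 ?gt_eqF// sub0r normrN ger0_norm ?powR_ge0//.
rewrite -[ltRHS](powRr1 (ltW e0)) -(mulVf (lt0r_neq0 p0)) powRrM.
by rewrite gt0_ltr_powR// nnegrE powR_ge0.
Unshelve. all: by end_near. Qed.

(** On [A] the function agrees with |F|^p, which is continuous everywhere. *)
Lemma within_continuous_powR (R : realType) (A : set R) (F : R -> R) (p : R) :
  0 < p -> continuous F -> (forall x, A x -> 0 <= F x) ->
  {within A, continuous (fun x => F x `^ p)}.
Proof.
move=> p0 cF F0; apply: (@subspace_eq_continuous _ _ _ (fun x => `|F x| `^ p)).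
  by move=> x /set_mem /F0 ?; rewrite /= ger0_norm.
apply: continuous_subspaceT => x.
by apply: (@continuous_comp _ _ _ F (fun y : R => `|y| `^ p));
  [exact: cF|exact: continuous_normr_powR].
Qed.

(** The intervals [1/(n+1), c] exhaust ]0, c] and avoid the singularity; on each, the antiderivative
    x^p / p bounds the integral by |c|^p / p, uniformly in n. *)
Lemma integrable_powR (R : realType) (p c : R) : 0 < p ->
  (@lebesgue_measure R).-integrable `]0, c] (fun x => (x `^ (p - 1))%:E).
Proof.
move=> p0; pose mu := @lebesgue_measure R.
have mpow D : measurable_fun D (fun x : R => (x `^ (p - 1))%:E).
  by apply/measurable_EFinP; apply: measurable_funTS; exact: measurable_powR.
apply/integrableP; split; first exact: mpow.
pose F (n : nat) : set (measurableTypeR R) := `[n.+1%:R^-1, c]%classic.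
have ndF : nondecreasing_seq F.
  move=> m n mn; apply/subsetPset => x /andP[mx xc]; apply/andP; split => //.
  rewrite !bnd_simp in mx *.
  by rewrite (le_trans _ mx)// lef_pV2 ?posrE// ler_nat.
have bF : \bigcup_n F n = `]0, c]%classic.
  apply/seteqP; split => x /=.
    move=> [n _] /andP[]; rewrite !bnd_simp => nx xc.
    by apply/andP; rewrite !bnd_simp (lt_le_trans _ nx)// invr_gt0.
  move=> /andP[]; rewrite !bnd_simp => x0 xc; exists (Num.trunc (x : R)^-1) => //.
  apply/andP; rewrite !bnd_simp; split => //.
  by rewrite invf_ple ?posrE// ltW//; exact: truncnS_gt.
have mF n : measurable (F n) by exact: measurable_itv.
have := @ge0_nondecreasing_set_cvg_integral _ _ R F
  (fun x => `|(x `^ (p - 1))%:E|%E) mu ndF mF.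
rewrite bF => cvgF.
have {}cvgF := cvgF (fun n => measurableT_comp (@abse_measurable _ _) (mpow _))
  (fun n x _ => abse_ge0 _).
suff : (\int[mu]_(x in `]0%R, c]) `|(x `^ (p - 1))%:E| <= (`|c| `^ p / p)%:E)%E.
  by move=> /le_lt_trans; apply; rewrite ltry.
rewrite -(cvg_lim _ cvgF)//; apply: lime_le; first by apply/cvg_ex; eexists; exact: cvgF.
apply: nearW => n.
have n0 : 0 < n.+1%:R^-1 :> R by rewrite invr_gt0.
have cp0 : 0 <= `|c| `^ p / p by rewrite divr_ge0 ?powR_ge0 ?ltW.
(* If c <= 1/(n+1), the interval has at most one point and the integral is 0. *)
have [nc|cn] := ltP n.+1%:R^-1 c; last first.
  rewrite (@integral_Sset1 _ _ _ c) ?lee_fin//.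
  move=> x; rewrite /F/= in_itv/= => /andP[nx xc].
  by apply/eqP; rewrite eq_le xc (le_trans cn).
have c0 : 0 < c by exact: lt_trans nc.
have -> : (\int[mu]_(x in F n) `|(x `^ (p - 1))%:E| =
    \int[mu]_(x in `[(n.+1%:R^-1)%R, c]) (x `^ (p - 1))%:E)%E.
  by apply: eq_integral => x _; rewrite gee0_abs// lee_fin powR_ge0.
have dF (x : R) : 0 < x -> is_derive x 1 (p^-1 \*: (@powR R ^~ p)) (x `^ (p - 1)).
  move=> x0; have := is_deriveZ p^-1 (is_derive1_powR p x0).
  by rewrite /GRing.scale/= mulrA mulVf ?gt_eqF// mul1r.
have cF (q : R) : {within `[n.+1%:R^-1, c], continuous (@powR R ^~ q)}.
  apply: derivable_within_continuous => x; rewrite in_itv/= => /andP[nx _].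
  by apply: derivable_powR; rewrite in_itv/= andbT (lt_le_trans n0).
rewrite (@continuous_FTC2 _ (fun x => x `^ (p - 1)) (p^-1 \*: (@powR R ^~ p)) _ _ nc) => //.
- rewrite -EFinB lee_fin gtr0_norm// /GRing.scale/= (mulrC _ p^-1).
  by rewrite gerBl mulr_ge0 ?powR_ge0 ?invr_ge0 ?ltW.
- have cG : {within `[n.+1%:R^-1, c], continuous (p^-1 \*: (@powR R ^~ p))}.
    by move=> x; apply: cvgZr; exact: cF.
  have [_ ? ?] := (continuous_within_itvP _ nc).1 cG.
  split => // x; rewrite in_itv/= => /andP[nx _].
  by case: (dF x (lt_trans n0 nx)).
- move=> x; rewrite in_itv/= => /andP[nx _].
  by rewrite derive1E; case: (dF x (lt_trans n0 nx)).
Qed.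

(** * Affine change of variables *)

(** By uniqueness of Lebesgue measure it is enough to compare both sides on the intervals ]a, b]. A
    negative [q] exchanges the ends, so that the preimage is closed on the left. *)
Lemma lebesgue_measure_affine (R : realType) (p q : R) (A : set R) :
  q != 0 -> measurable A ->
  lebesgue_measure A =
  (`|q|%:E * pushforward (@lebesgue_measure R) (fun x : R => (p + q * x)%R) A)%E.
Proof.
move=> q0 mA.
pose phi (x : measurableTypeR R) : measurableTypeR R := p + q * x.
have mphi : measurable_fun setT phi.
  by apply: measurable_funD => //; exact: measurable_funM.
pose q' : {nonneg R} := NngNum (normr_ge0 q).
pose m : {measure set (measurableTypeR R) -> \bar R} :=
  mscale q' (pushforward (@lebesgue_measure R) phi).
rewrite -[RHS]/(m mphi A); apply: lebesgue_measure_unique => // _ [[a b] _ <-].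
rewrite /m/= /mscale/= /pushforward/= lebesgue_measure_itv/=.
have [qgt|qlt] := ltP 0 q.
  have -> : (fun x : R => p + q * x) @^-1` `]a, b] = `](a - p) / q, (b - p) / q]%classic.
    apply/seteqP; split => x /=;
      by rewrite !in_itv/= ltr_pdivrMr// ler_pdivlMr// ltrBlDl lerBrDl mulrC.
  rewrite lebesgue_measure_itv/= !lte_fin ltr_pM2r ?invr_gt0// ltrD2r.
  case: ifPn => _; last by rewrite mule0.
  rewrite -!EFinB -EFinM gtr0_norm//; congr EFin; field.
  by rewrite gt_eqF.
have {}qlt : q < 0 by rewrite lt_neqAle q0.
have -> : (fun x : R => p + q * x) @^-1` `]a, b] = `[(b - p) / q, (a - p) / q[%classic.
  apply/seteqP; split => x /=;
    by rewrite !in_itv/= ltr_ndivlMr// ler_ndivrMr// ltrBlDl lerBrDl mulrC andbC.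
rewrite lebesgue_measure_itv/= !lte_fin ltr_nM2r ?invr_lt0// ltrD2r.
case: ifPn => _; last by rewrite mule0.
rewrite -!EFinB -EFinM ltr0_norm//; congr EFin; field.
by rewrite lt_eqF.
Qed.

Lemma ge0_integral_affine (R : realType) (p q : R) (D : set R) (f : R -> \bar R) :
  q != 0 -> measurable D -> measurable_fun D f -> (forall x, D x -> 0 <= f x)%E ->
  (\int[lebesgue_measure]_(x in D) f x =
   `|q|%:E * \int[lebesgue_measure]_(x in (fun x => p + q * x)%R @^-1` D) f (p + q * x)%R)%E.
Proof.
move=> q0 mD mf f0.
pose phi (x : measurableTypeR R) : measurableTypeR R := p + q * x.
have mphi : measurable_fun setT phi.
  by apply: measurable_funD => //; exact: measurable_funM.
pose q' : {nonneg R} := NngNum (normr_ge0 q).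
pose m : {measure set (measurableTypeR R) -> \bar R} :=
  mscale q' (pushforward (@lebesgue_measure R) phi).
rewrite (eq_measure_integral (m mphi)); last first.
  by move=> A mA _; exact: (lebesgue_measure_affine p q0).
rewrite ge0_integral_mscale//; congr (_ * _)%E.
by rewrite ge0_integral_pushforward// => x /set_mem; exact: f0.
Qed.

Lemma integrable_affine (R : realType) (p q : R) (D : set R) (f : R -> \bar R) :
  q != 0 -> measurable D -> (@lebesgue_measure R).-integrable D f ->
  (@lebesgue_measure R).-integrable ((fun x => p + q * x) @^-1` D)
    (fun x => f (p + q * x)).
Proof.
move=> q0 mD /integrableP[mf foo].
have mphi : measurable_fun setT (fun x : R => p + q * x).
  by apply: measurable_funD => //; exact: measurable_funM.
have mE : measurable ((fun x => p + q * x) @^-1` D).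
  by rewrite -[X in measurable X]setTI; exact: mphi.
apply/integrableP; split.
  apply: (measurable_comp (F := D)) => //; first by move=> _ [x ? <-].
  exact: measurable_funTS.
move: foo; rewrite (ge0_integral_affine p q0)//; last exact: measurableT_comp.
move=> h; rewrite ltey; apply/eqP => e; move: h; rewrite e.
by rewrite gt0_muley// lte_fin normr_gt0.
Qed.

Lemma ge0_Rintegral_affine (R : realType) (p q : R) (D : set R) (f : R -> R) :
  q != 0 -> measurable D -> (@lebesgue_measure R).-integrable D (EFin \o f) ->
  (forall x, D x -> 0 <= f x) ->
  \int[lebesgue_measure]_(x in D) f x =
  `|q| * \int[lebesgue_measure]_(x in (fun x => p + q * x) @^-1` D) f (p + q * x).
Proof.
move=> q0 mD intf f0.
have mE : measurable ((fun x => p + q * x) @^-1` D).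
  have mphi : measurable_fun setT (fun x : R => p + q * x).
    by apply: measurable_funD => //; exact: measurable_funM.
  by rewrite -[X in measurable X]setTI; exact: mphi.
rewrite /Rintegral (ge0_integral_affine p q0)//=; last exact: measurable_int intf.
by rewrite fineM//; exact: (integrable_fin_num _ (integrable_affine p q0 mD intf)).
Qed.

(** * The Gamma function: convergence, positivity, functional equation *)

Lemma cvg_expR_half (R : realType) : expR (- (x / 2)) @[x --> +oo%R] --> (0 : R).
Proof.
apply: (@cvg_comp _ _ _ (fun x : R => x / 2) (fun x => expR (- x)) _ +oo).
  exact: gt0_cvgMly.
exact: cvgr_expR.
Qed.

(** Majorant for the tail of Euler's integral; the antiderivative -2 exp(-x/2) tends to 0 at
    infinity. *)
Lemma integrable_expR_half (R : realType) :
  (@lebesgue_measure R).-integrable `]0, +oo[ (fun x => (expR (- (x / 2)))%:E).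
Proof.
have dF (x : R) : is_derive x 1 (fun x => -2 * expR (- (x / 2))) (expR (- (x / 2))).
  by apply: is_derive_eq; rewrite /GRing.scale/=; field.
have me D : measurable_fun D (fun x : R => expR (- (x / 2))).
  apply: measurableT_comp => //; apply: measurable_funTS.
  by apply: measurableT_comp => //; exact: measurable_funM.
apply/integrableP; split; first by apply/measurable_EFinP; exact: me.
under eq_integral => x _ do rewrite gee0_abs ?lee_fin ?expR_ge0//.
rewrite integral_itv_obnd_cbnd; last by apply/measurable_EFinP; exact: me.
have cderiv (F : R -> R) : (forall x, derivable F x 1) -> continuous F.
  by move=> dF' x; apply: differentiable_continuous; exact/derivable1_diffP.
have ce : continuous (fun x : R => expR (- (x / 2))).
  by apply: cderiv => x; apply: ex_derive.
have cF : continuous (fun x : R => - 2 * expR (- (x / 2))).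
  by apply: cderiv => x; apply: ex_derive.
rewrite (@ge0_continuous_FTC2y _ _ (fun x => -2 * expR (- (x / 2))) 0 0).
- by rewrite -EFinB ltry.
- by move=> x _; exact: expR_ge0.
- exact: continuous_subspaceT.
- by rewrite -(mulr0 (-2)); apply: cvgMr; exact: cvg_expR_half.
- by move=> x _; case: (dF x).
- by apply: cvg_at_right_filter; exact: cF.
- by move=> x _; rewrite derive1E; case: (dF x).
Qed.

Definition gamma_density (R : realType) (p x : R) : R := x `^ (p - 1) * expR (- x).

Lemma gamma_density_ge0 (R : realType) (p x : R) : 0 <= gamma_density p x.
Proof. by rewrite mulr_ge0 ?powR_ge0 ?expR_ge0. Qed.

Lemma measurable_gamma_density (R : realType) (p : R) (D : set R) :
  measurable_fun D (gamma_density p).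
Proof.
apply: measurable_funTS; apply: measurable_funM; first exact: measurable_powR.
by apply: measurableT_comp => //; exact: measurable_oppr.
Qed.

(** The majorant is x^(p-1) on ]0, 1], where exp(-x) <= 1, plus C exp(-x/2), which takes over for x
    >= 1. *)
Lemma integrable_gamma_density (R : realType) (p : R) : 0 < p ->
  (@lebesgue_measure R).-integrable `]0, +oo[ (EFin \o gamma_density p).
Proof.
move=> p0; have [C C0 powC] := powR_le_expR p0.
pose g x := (((fun x => x `^ (p - 1)) \_ (`]0, 1] : set R)) x + C * expR (- (x / 2)))%:E.
have ig : (@lebesgue_measure R).-integrable `]0, +oo[ g.
  rewrite /g; under [X in integrable _ _ X]eq_fun do rewrite EFinD EFinM.
  apply: integrableD => //; last by apply: integrableZl => //; exact: integrable_expR_half.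
  rewrite -[X in integrable _ _ X]/(EFin \o _) -restrict_EFin.
  apply/integrable_restrict => //; rewrite setIidr; last by apply: subset_itvl; rewrite bnd_simp.
  exact: integrable_powR.
apply: (le_integrable _ _ _ ig) => //.
  by apply/measurable_EFinP; exact: measurable_gamma_density.
move=> x /=; rewrite in_itv/= andbT => x0.
rewrite lee_fin ger0_norm ?gamma_density_ge0// ger0_norm; last first.
  apply: addr_ge0; last by rewrite mulr_ge0 ?expR_ge0 ?ltW.
  by rewrite patchE; case: ifPn => _; rewrite ?powR_ge0.
rewrite patchE; case: ifPn => [_|/negP x1].
  rewrite -[leLHS]addr0; apply: lerD; last by rewrite mulr_ge0 ?expR_ge0 ?ltW.
  by rewrite /gamma_density ler_piMr ?powR_ge0// -expR0 ler_expR oppr_le0 ltW.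
have {}x1 : 1 <= x.
  by rewrite leNgt; apply/negP => x1'; apply: x1; rewrite inE/= in_itv/= x0 ltW.
(* For x >= 1, x^(p-1) <= x^p <= C exp(x/2); passing to the exponent p makes [powC] applicable. *)
rewrite add0r /gamma_density.
have -> : expR (- (x / 2)) = expR (x / 2) * expR (- x) by rewrite -expRD; congr expR; field.
rewrite mulrA ler_wpM2r ?expR_ge0//; apply: le_trans (powC _ x0).
by rewrite ler_powR// gerBl.
Qed.

Lemma integrable_itv_obnd_cbnd (R : realType) (a : R) (b : itv_bound R)
    (f : R -> \bar R) :
  (@lebesgue_measure R).-integrable [set` Interval (BRight a) b] f ->
  (@lebesgue_measure R).-integrable [set` Interval (BLeft a) b] f.
Proof.
move=> /integrableP[mf foo]; apply/integrableP.
split; first exact/emeasurable_fun_itv_obnd_cbndP.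
by rewrite -integral_itv_obnd_cbnd//; exact: measurableT_comp.
Qed.

Lemma Gamma_gt0 (R : realType) (p : R) : 0 < p -> 0 < Gamma p.
Proof.
move=> p0; pose mu := @lebesgue_measure R.
(* On [1, 2], x^(p-1) >= 1/x >= 1/2 because p > 0, and exp(-x) >= exp(-2); the interval has length
   1, so [k] also bounds the integral from below. *)
pose k : R := 2^-1 * expR (- 2).
have k0 : 0 < k by rewrite mulr_gt0 ?invr_gt0// expR_gt0.
have ip := integrable_gamma_density p0.
have sub12 : `[1, 2] `<=` (`]0, +oo[ : set R).
  by move=> x /=; rewrite !in_itv/= andbT => /andP[x1 _]; exact: lt_le_trans x1.
have mg := measurable_gamma_density p.
have kE : (\int[mu]_(x in `[1%R, 2%R]) k%:E = k%:E)%E.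
  rewrite integral_cst//= /mu lebesgue_measure_itv/= lte_fin ltr1n -EFinB -EFinM.
  by congr EFin; ring.
have : (k%:E <= \int[mu]_(x in `]0%R, +oo[) (gamma_density p x)%:E)%E.
  rewrite -[leLHS]kE.
  apply: (@le_trans _ _ (\int[mu]_(x in `[1%R, 2%R]) (gamma_density p x)%:E)%E).
    apply: ge0_le_integral => //.
    - by move=> x _; rewrite lee_fin ltW.
    - by apply/measurable_EFinP; exact: mg.
    - move=> x /=; rewrite in_itv/= => /andP[x1 x2]; rewrite lee_fin.
      have x0 : 0 < x by exact: lt_le_trans x1.
      rewrite /k /gamma_density; apply: ler_pM.
      + by rewrite invr_ge0.
      + exact: expR_ge0.
      + apply: (@le_trans _ _ (x^-1)); first by rewrite lef_pV2 ?posrE.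
        by rewrite -(powR_inv1 (ltW x0)) ler_powR// lerBrDl subrr ltW.
      + by rewrite ler_expR lerN2.
  apply: ge0_subset_integral => //; first by apply/measurable_EFinP; exact: mg.
  by move=> x _; rewrite lee_fin gamma_density_ge0.
rewrite /Gamma /Rintegral -/mu.
rewrite -[X in (_ <= X)%E]fineK; last exact: integrable_fin_num ip.
by rewrite lee_fin; exact: lt_le_trans.
Qed.

(** Monotone convergence along ]0, n]; it lets the functional equation be derived on bounded
    intervals. *)
Lemma incomplete_Gamma_cvg (R : realType) (p : R) : 0 < p ->
  \int[lebesgue_measure]_(x in `]0, n%:R]) gamma_density p x @[n --> \oo] -->
  Gamma p.
Proof.
move=> p0; pose mu := @lebesgue_measure R.
have ip := integrable_gamma_density p0.
have mg D : measurable_fun D (fun x => (gamma_density p x)%:E).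
  by apply/measurable_EFinP; exact: measurable_gamma_density.
pose F (n : nat) : set (measurableTypeR R) := `]0, n%:R]%classic.
have ndF : nondecreasing_seq F.
  move=> m n mn; apply/subsetPset; apply: subset_itvl.
  by rewrite bnd_simp ler_nat.
have bF : \bigcup_n F n = `]0, +oo[%classic.
  apply/seteqP; split => x.
    by move=> [n _] /andP[]; rewrite !bnd_simp => x0 _; apply/andP.
  move=> /andP[]; rewrite bnd_simp => x0 _; exists (Num.trunc (x : R)).+1 => //.
  by apply/andP; rewrite !bnd_simp; split => //; rewrite ltW//; exact: truncnS_gt.
have mF n : measurable (F n) by exact: measurable_itv.
have := @ge0_nondecreasing_set_cvg_integral _ _ R F
  (fun x => (gamma_density p x)%:E) mu ndF mF (fun n => mg _)
  (fun n x _ => gamma_density_ge0 p x).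
rewrite bF.
have -> : (\int[mu]_(x in `]0%R, +oo[) (gamma_density p x)%:E = (Gamma p)%:E)%E.
  by rewrite /Gamma /Rintegral fineK//; exact: integrable_fin_num ip.
by move=> /fine_cvg.
Qed.

(** Integration by parts: x^p exp(-x) has derivative p x^(p-1) exp(-x) - x^p exp(-x), unbounded near
    0 when p < 1 but integrable, so [Rintegral_derive] applies on [0, n+1]. The boundary term
    vanishes in the limit. *)
Lemma GammaD1 (R : realType) (p : R) : 0 < p -> Gamma (p + 1) = p * Gamma p.
Proof.
move=> p0; pose mu := @lebesgue_measure R.
have p10 : 0 < p + 1 by exact: addr_gt0.
have [C C0 powC] := powR_le_expR p0.
pose I q (n : nat) := \int[mu]_(x in `]0, n%:R]) gamma_density q x.
have cI q : 0 < q -> I q n @[n --> \oo] --> Gamma q by exact: incomplete_Gamma_cvg.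
have iI q (n : nat) : 0 < q -> mu.-integrable `]0, n%:R] (EFin \o gamma_density q).
  move=> q0; apply: integrableS (integrable_gamma_density q0) => //.
  by apply: subset_itvl; rewrite bnd_simp.
have iI0 q (n : nat) : 0 < q -> mu.-integrable `[0, n%:R] (EFin \o gamma_density q).
  by move=> q0; apply: integrable_itv_obnd_cbnd; exact: iI.
(* The index [n.+1] keeps the interval nondegenerate; at 0 the boundary term is 0^p = 0. *)
have IE (n : nat) : p * I p n.+1 - I (p + 1) n.+1 = n.+1%:R `^ p * expR (- n.+1%:R).
  rewrite /I !Rintegral_itv_obnd_cbnd; [|exact: iI..].
  rewrite -RintegralZl//; last exact: iI0.
  have iZ : mu.-integrable `[0, n.+1%:R] (EFin \o (fun x => p * gamma_density p x)).
    by apply: (integrableZl _ p (iI0 _ _ p0)).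
  rewrite -RintegralB//; last exact: iI0.
  have -> : n.+1%:R `^ p * expR (- n.+1%:R) =
      n.+1%:R `^ p * expR (- n.+1%:R) - 0 `^ p * expR (- 0) :> R.
    by rewrite powR0 ?gt_eqF// mul0r subr0.
  apply: (Rintegral_derive (G := fun x => x `^ p * expR (- x))) => //.
  - move=> x; apply: cvgM; first apply: (within_continuous_powR (F := id)) => //.
    + by move=> y; exact: cvg_id.
    + by move=> y /= ; rewrite in_itv/= => /andP[].
    apply: continuous_subspaceT => {}x; apply: continuous_comp; first exact: oppr_continuous.
    exact: continuous_expR.
  - move=> x; rewrite in_itv/= => /andP[x0 _].
    have ? := is_derive1_powR p x0.
    apply: is_derive_eq; rewrite /GRing.scale/= /gamma_density addrK; ring.
  - by apply: (integrableB _ iZ (iI0 _ _ p10)).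
have h : p * I p n.+1 - I (p + 1) n.+1 @[n --> \oo] --> p * Gamma p - Gamma (p + 1).
  apply: cvgB.
    by apply: cvgMl_tmp; have := cI _ p0; rewrite -(cvg_shiftS (I p)).
  by have := cI _ p10; rewrite -(cvg_shiftS (I (p + 1))).
(* The boundary term is squeezed between 0 and C exp(-(n+1)/2). *)
have h0 : p * I p n.+1 - I (p + 1) n.+1 @[n --> \oo] --> 0.
  under eq_fun do rewrite IE.
  apply: (@squeeze_cvgr _ _ _ _ (cst 0) (fun n : nat => C * expR (- (n.+1%:R / 2)))).
  - near=> n; rewrite mulr_ge0 ?powR_ge0 ?expR_ge0//=.
    have -> : expR (- (n.+1%:R / 2)) = expR (n.+1%:R / 2) * expR (- n.+1%:R) :> R.
      by rewrite -expRD; congr expR; field.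
    by rewrite mulrA ler_wpM2r ?expR_ge0// powC.
  - exact: cvg_cst.
  - rewrite -(mulr0 C); apply: cvgMr.
    apply: (@cvg_comp _ _ _ (fun n : nat => n.+1%:R : R) (fun x => expR (- (x / 2))) _ +oo).
      by rewrite (cvg_shiftS (fun n => n%:R : R)); exact: cvgr_idn.
    exact: cvg_expR_half.
by apply/eqP; rewrite eq_sym -subr_eq0; apply/eqP; exact: (cvg_unique _ h h0).
Unshelve. all: by end_near. Qed.

(** * The trapezoid identity *)

(** [F] is bounded on the compact segment. *)
Lemma integrable_continuousM (R : realType) (u v : R) (F g : R -> R) :
  {within `[u, v], continuous F} ->
  (@lebesgue_measure R).-integrable `[u, v] (EFin \o g) ->
  (@lebesgue_measure R).-integrable `[u, v] (EFin \o (F \* g)).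
Proof.
move=> cF ig.
have : (@lebesgue_measure R).-integrable `[u, v] ((EFin \o F) \* (EFin \o g))%E.
  apply: integrableMr => //.
  - by apply: subspace_continuous_measurable_fun => //; exact: measurable_itv.
  - have /compact_bounded [M [Mr HM]] := continuous_compact cF (segment_compact (a:=u) (b:=v)).
    by exists M; split => // N MN x xuv; apply: (HM _ MN); exists x.
by apply: eq_integrable => // x _; rewrite /= EFinM.
Qed.

Section trapezoid_identity.
Variables (R : realType) (a c alpha : R).
Hypotheses (c_gt0 : 0 < c) (alpha_gt0 : 0 < alpha).
Let mu := @lebesgue_measure R.

(** The function P of the proof sketch. Its derivative is proportional to the sum of the two
    Riemann-Liouville kernels. *)
Definition trapezoid_weight (x : R) : R :=
  ((x - a) `^ alpha - (a + c - x) `^ alpha) / c `^ alpha.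

Definition trapezoid_kernel (x : R) : R :=
  (c `^ (alpha + 1) - (x - a) `^ (alpha + 1) - (a + c - x) `^ (alpha + 1)) /
  ((alpha + 1) * c `^ alpha).

Lemma is_derive_powR_subl (p x : R) : a < x ->
  is_derive x 1 (fun x => (x - a) `^ p) (p * (x - a) `^ (p - 1)).
Proof.
move=> ax; have xa0 : 0 < x - a by rewrite subr_gt0.
have du : is_derive x 1 (fun x : R => x - a) 1.
  by apply: is_derive_eq; rewrite subr0.
have := @is_derive1_comp _ (@powR R ^~ p) (fun x => x - a) x _ _
  (is_derive1_powR p xa0) du.
by rewrite mulr1.
Qed.

Lemma is_derive_powR_subr (p x : R) : x < a + c ->
  is_derive x 1 (fun x => (a + c - x) `^ p) (- (p * (a + c - x) `^ (p - 1))).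
Proof.
move=> xc; have xc0 : 0 < a + c - x by rewrite subr_gt0.
have du : is_derive x 1 (fun x : R => a + c - x) (-1).
  by apply: is_derive_eq; ring.
have := @is_derive1_comp _ (@powR R ^~ p) (fun x => a + c - x) x _ _
  (is_derive1_powR p xc0) du.
by rewrite mulrN1.
Qed.

Lemma is_derive_trapezoid_weight (x : R) : a < x < a + c ->
  is_derive x 1 trapezoid_weight
    (alpha / c `^ alpha * ((x - a) `^ (alpha - 1) + (a + c - x) `^ (alpha - 1))).
Proof.
move=> /andP[ax xc].
have d1 := is_derive_powR_subl alpha ax.
have d2 := is_derive_powR_subr alpha xc.
rewrite /trapezoid_weight.
by apply: is_derive_eq; rewrite /GRing.scale/=; ring.
Qed.

Lemma is_derive_trapezoid_kernel (x : R) : a < x < a + c ->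
  is_derive x 1 trapezoid_kernel (- trapezoid_weight x).
Proof.
move=> /andP[ax xc].
have d1 := is_derive_powR_subl (alpha + 1) ax.
have d2 := is_derive_powR_subr (alpha + 1) xc.
rewrite /trapezoid_kernel /trapezoid_weight.
have c0 : c `^ alpha != 0 by rewrite gt_eqF ?powR_gt0.
have a1 : alpha + 1 != 0 by rewrite gt_eqF// addr_gt0.
apply: is_derive_eq; rewrite /GRing.scale/= addrK; field.
by rewrite c0.
Qed.

Lemma continuous_powR_subl (p : R) : 0 < p ->
  {within `[a, a + c], continuous (fun x => (x - a) `^ p)}.
Proof.
move=> p0; apply: within_continuous_powR => //.
  by move=> x; apply: cvgB; [exact: cvg_id|exact: cvg_cst].
by move=> x /=; rewrite in_itv/= subr_ge0 => /andP[].
Qed.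

Lemma continuous_powR_subr (p : R) : 0 < p ->
  {within `[a, a + c], continuous (fun x => (a + c - x) `^ p)}.
Proof.
move=> p0; apply: within_continuous_powR => //.
  by move=> x; apply: cvgB; [exact: cvg_cst|exact: cvg_id].
by move=> x /=; rewrite in_itv/= subr_ge0 => /andP[].
Qed.

Lemma continuous_trapezoid_weight : {within `[a, a + c], continuous trapezoid_weight}.
Proof.
move=> x; apply: cvgM; last exact: cvg_cst.
by apply: cvgB; [exact: continuous_powR_subl|exact: continuous_powR_subr].
Qed.

Lemma continuous_trapezoid_kernel : {within `[a, a + c], continuous trapezoid_kernel}.
Proof.
have a1 : 0 < alpha + 1 by exact: addr_gt0.
move=> x; apply: cvgM; last exact: cvg_cst.
apply: cvgB; last exact: continuous_powR_subr.
by apply: cvgB; [exact: cvg_cst|exact: continuous_powR_subl].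
Qed.

(** Translation of the power on ]0, c]; its possible singularity moves from 0 to [a]. *)
Lemma integrable_powR_subl :
  mu.-integrable `[a, a + c] (EFin \o (fun x => (x - a) `^ (alpha - 1))).
Proof.
have := integrable_affine (- a) (oner_neq0 R) (measurable_itv _)
  (integrable_itv_obnd_cbnd (integrable_powR c alpha_gt0)).
have -> : (fun x => - a + 1 * x) @^-1` `[0, c] = `[a, a + c]%classic.
  apply/seteqP; split => x /=; rewrite !in_itv/= mul1r => /andP[? ?]; apply/andP; split; lra.
by apply: eq_integrable => // x _; rewrite /= mul1r addrC.
Qed.

Lemma integrable_powR_subr :
  mu.-integrable `[a, a + c] (EFin \o (fun x => (a + c - x) `^ (alpha - 1))).
Proof.
have N1 : -1 != 0 :> R by rewrite oppr_eq0 oner_neq0.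
have := integrable_affine (a + c) N1 (measurable_itv _)
  (integrable_itv_obnd_cbnd (integrable_powR c alpha_gt0)).
have -> : (fun x => a + c + -1 * x) @^-1` `[0, c] = `[a, a + c]%classic.
  apply/seteqP; split => x /=; rewrite !in_itv/= mulN1r => /andP[? ?]; apply/andP; split; lra.
by apply: eq_integrable => // x _; rewrite /= mulN1r.
Qed.

Lemma trapezoid_identity (f f' f'' : R -> R) :
  (forall x : R, x \in `[a, a + c] -> is_derive x 1 f (f' x)) ->
  (forall x : R, x \in `[a, a + c] -> is_derive x 1 f' (f'' x)) ->
  mu.-integrable `[a, a + c] (EFin \o f'') ->
  f a + f (a + c) -
    Gamma (alpha + 1) / c `^ alpha *
      (RL_right alpha a f (a + c) + RL_left alpha (a + c) f a) =
  \int[mu]_(x in `[a, a + c]) (trapezoid_kernel x * f'' x).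
Proof.
move=> df df' if''.
have cG (G G' : R -> R) : (forall x : R, x \in `[a, a + c] -> is_derive x 1 G (G' x)) ->
    {within `[a, a + c], continuous G}.
  by move=> dG; apply: derivable_within_continuous => x /dG [].
have cf := cG _ _ df; have cf' := cG _ _ df'.
have ic := lt0r_neq0 (powR_gt0 alpha c_gt0).
have a1 : 0 < alpha + 1 by exact: addr_gt0.
(* [K] is Q f' + P f, and [w] is P' up to the factor alpha / c^alpha. *)
pose K := (fun x => trapezoid_kernel x * f' x + trapezoid_weight x * f x).
pose w x := (x - a) `^ (alpha - 1) + (a + c - x) `^ (alpha - 1).
have iwf : mu.-integrable `[a, a + c] (EFin \o (f \* w)).
  apply: integrable_continuousM => //.
  exact: (integrableD _ integrable_powR_subl integrable_powR_subr).
have iQ : mu.-integrable `[a, a + c] (EFin \o (trapezoid_kernel \* f'')).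
  by apply: integrable_continuousM => //; exact: continuous_trapezoid_kernel.
have ifl : mu.-integrable `[a, a + c] (EFin \o (fun x => (x - a) `^ (alpha - 1) * f x)).
  have := integrable_continuousM cf integrable_powR_subl.
  by apply: eq_integrable => // x _; rewrite /= mulrC.
have ifr : mu.-integrable `[a, a + c] (EFin \o (fun x => (a + c - x) `^ (alpha - 1) * f x)).
  have := integrable_continuousM cf integrable_powR_subr.
  by apply: eq_integrable => // x _; rewrite /= mulrC.
have iL : mu.-integrable `[a, a + c] (EFin \o (fun x => alpha / c `^ alpha * (f x * w x))).
  exact: (integrableZl _ (alpha / c `^ alpha) iwf).
have := @Rintegral_derive R K
  (fun x => trapezoid_kernel x * f'' x + alpha / c `^ alpha * (f x * w x)) a (a + c).
rewrite RintegralD// RintegralZl//.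
(* The powers of a + c - x belong to the right-sided fractional integral at a + c, those of x - a to
   the left-sided one at a. *)
have -> : \int[mu]_(x in `[a, a + c]) (f x * w x) =
   \int[mu]_(x in `[a, a + c]) ((a + c - x) `^ (alpha - 1) * f x) +
   \int[mu]_(x in `[a, a + c]) ((x - a) `^ (alpha - 1) * f x).
  rewrite -RintegralD//; apply: eq_Rintegral => x _; rewrite /w; ring.
have cE : a + c - a = c by ring.
(* Q vanishes at both ends, so f' drops out; P contributes the signs 1 and -1. *)
have -> : K (a + c) - K a = f a + f (a + c).
  have ->: K (a + c) = f (a + c).
    rewrite /K /trapezoid_kernel /trapezoid_weight.
    rewrite cE (subrr (a + c)) !powR0 ?gt_eqF// !subr0 subrr mul0r mul0r add0r.
    by rewrite divff// mul1r.
  have ->: K a = - f a.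
    rewrite /K /trapezoid_kernel /trapezoid_weight.
    rewrite cE (subrr a) !powR0 ?gt_eqF// !subr0 subrr mul0r mul0r add0r.
    by rewrite sub0r mulNr divff// mulN1r.
  by rewrite opprK addrC.
set L := (X in _ -> _ -> _ -> _ -> X = _) => h.
have aac : a < a + c by rewrite ltrDl.
have cK : {within `[a, a + c], continuous K}.
  move=> x; apply: cvgD; apply: cvgM; [exact: continuous_trapezoid_kernel|exact: cf'
    |exact: continuous_trapezoid_weight|exact: cf].
have dK (x : R) : x \in `]a, a + c[ ->
    is_derive x 1 K (trapezoid_kernel x * f'' x + alpha / c `^ alpha * (f x * w x)).
  rewrite in_itv/= => axc; have /andP[ax xc] := axc.
  have xI : x \in `[a, a + c] by rewrite in_itv/= !ltW.
  have d1 := df _ xI; have d2 := df' _ xI.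
  have d3 := is_derive_trapezoid_kernel axc.
  have d4 := is_derive_trapezoid_weight axc.
  by rewrite /K; apply: is_derive_eq; rewrite /GRing.scale/= /w; ring.
have itot : mu.-integrable `[a, a + c] (EFin \o
    (fun x => trapezoid_kernel x * f'' x + alpha / c `^ alpha * (f x * w x))).
  exact: (integrableD _ iQ iL).
have {}h := h aac cK dK itot.
(* Gamma(alpha + 1) = alpha Gamma(alpha) absorbs the normalization of the fractional integrals and
   leaves the factor alpha of P'. *)
rewrite -h /L {h L} GammaD1// /RL_right /RL_left -mulrDr.
have := lt0r_neq0 (Gamma_gt0 alpha_gt0).
set A := Gamma _; set X := \int[_]_(_ in _) _; set Y := \int[_]_(_ in _) _.
set Z := \int[_]_(_ in _) _ => A0.
by field; rewrite A0 ic.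
Qed.

(** By homogeneity a factor c^(alpha+1) / c^alpha = c comes out, leaving the weight of the final
    estimate. *)
Lemma trapezoid_kernelE (t : R) : t \in `[0, 1] ->
  trapezoid_kernel (a + t * c) =
  c * ((1 - (1 - t) `^ (alpha + 1) - t `^ (alpha + 1)) / (alpha + 1)).
Proof.
rewrite in_itv/= => /andP[t0 t1]; rewrite /trapezoid_kernel.
have -> : a + t * c - a = t * c by ring.
have -> : a + c - (a + t * c) = (1 - t) * c by ring.
have c0 := ltW c_gt0.
rewrite !powRM ?subr_ge0//.
have -> : c `^ (alpha + 1) = c `^ alpha * c.
  by rewrite powRD ?powRr1// (gt_eqF c_gt0) implybT.
have ic := lt0r_neq0 (powR_gt0 alpha c_gt0).
have a1 : alpha + 1 != 0 by rewrite gt_eqF// addr_gt0.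
by field; rewrite ic a1.
Qed.

End trapezoid_identity.

(** * The estimate under preinvexity *)

(** On [0, 1], s^(alpha+1) <= s; for s = t and s = 1 - t these bounds add up to 1. *)
Lemma unit_trapezoid_kernel_ge0 (R : realType) (alpha t : R) :
  0 < alpha -> t \in `[0, 1] ->
  0 <= (1 - (1 - t) `^ (alpha + 1) - t `^ (alpha + 1)) / (alpha + 1).
Proof.
move=> alpha0; rewrite in_itv/= => /andP[t0 t1].
have a1 : 0 < alpha + 1 by exact: addr_gt0.
have le_id (s : R) : 0 <= s -> s <= 1 -> s `^ (alpha + 1) <= s.
  rewrite le_eqVlt => /predU1P[<- _|s0 s1]; first by rewrite powR0 ?gt_eqF.
  by rewrite ge1r_powR// ?s0// lerDr ltW.
rewrite divr_ge0 ?(ltW a1)//.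
have h1 := le_id _ t0 t1.
have : (1 - t) `^ (alpha + 1) <= 1 - t by apply: le_id; lra.
lra.
Qed.

(** Imaginary parts give sin phi = 0, while sin is positive on ]0, pi/2]; hence phi = 0. *)
Lemma expi_mul_real (R : realType) (phi c e : R) :
  phi \in `[0, pi / 2] -> 0 < e -> c%:C = expi phi * e%:C ->
  expi phi = 1 /\ c = e.
Proof.
rewrite in_itv/= => /andP[p0 p1] e0.
rewrite /expi => /eqP; rewrite eq_complex/= => /andP[/eqP cE /eqP sE].
have sinphi : sin phi = 0.
  move: sE; rewrite mulr0 add0r => /esym/eqP; rewrite mulf_eq0 (gt_eqF e0) orbF.
  by move=> /eqP.
have phi0 : phi = 0.
  move: p0; rewrite le_eqVlt => /predU1P[//|p0].
  have : 0 < sin phi.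
    apply: sin_gt0_pi; rewrite p0/=; apply: le_lt_trans p1 _.
    by rewrite ltr_pdivrMr// ltr_pMr ?pi_gt0// ltr1n.
  by rewrite sinphi ltxx.
move: cE; rewrite phi0 cos0 sin0 mul1r mul0r subr0 => ->; split => //.
Qed.

Unset Implicit Arguments.

Theorem theorem4 (R : realType) (phi : R) (I : set R) (eta : R -> R -> R)
    (a b c alpha : R) (f h : R -> R) (J : set R)
    (hphi : phi \in `[0, pi / 2])
    (Iopen : open I) (Iinvex : phi_invex phi eta I)
    (Ia : I a) (Ib : I b) (eta_gt0 : 0 < eta b a)
    (cE : c%:C = expi phi * (eta b a)%:C)
    (f_diff : forall x, I x -> derivable f x 1)
    (f'_diff : forall x, I x -> derivable (f^`())%classic x 1)
    (f''_L1 : lebesgue_measure.-integrable `[a, a + c]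
                (fun x => ((f^`(2))%classic x)%:E))
    (alpha_gt0 : 0 < alpha)
    (J01 : `[0, 1] `<=` J) (h_ge0 : forall t, J t -> 0 <= h t)
    (h_int : lebesgue_measure.-integrable `[0, 1]
       (fun t : R => ((1 - (1 - t) `^ (alpha + 1) - t `^ (alpha + 1)) /
                      (alpha + 1) * h t)%:E))
    (f''_preinvex : h_phi_preinvex h phi eta I (fun x => `|(f^`(2))%classic x|)) :
  `|f a + f (a + c) -
    Gamma (alpha + 1) / c `^ alpha *
      (RL_right alpha a f (a + c) + RL_left alpha (a + c) f a)|
  <= c ^+ 2 *
     ((`|(f^`(2))%classic a| + `|(f^`(2))%classic b|) *
      \int[lebesgue_measure]_(t in `[0, 1])
        ((1 - (1 - t) `^ (alpha + 1) - t `^ (alpha + 1)) /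
         (alpha + 1) * h t)).
Proof.
have [expi1 ceta] := expi_mul_real hphi eta_gt0 cE.
have c0 : 0 < c by rewrite ceta.
have cN0 := lt0r_neq0 c0.
pose mu := @lebesgue_measure R.
have pointE t : phi_point phi eta a b t = (a + t * c)%:C.
  by rewrite /phi_point expi1 mulr1 -ceta -rmorphM -rmorphD.
(* With angle 0, invexity from [a] towards [b] puts the whole segment [a, a + c] in [I]. *)
have Iseg t : t \in `[0, 1] -> I (a + t * c).
  move=> t01; have [y Iy] := Iinvex _ _ _ Ia Ib t01.
  by rewrite pointE => -[<-].
have seg x : x \in `[a, a + c] -> exists2 t, t \in `[0, 1] & x = a + t * c.
  rewrite in_itv/= => /andP[ax xc]; exists ((x - a) / c); last by field.
  by rewrite in_itv/= divr_ge0 ?subr_ge0 ?(ltW c0)//= ler_pdivrMr// mul1r lerBlDl.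
have Ix x : x \in `[a, a + c] -> I x by move=> /seg[t t01 ->]; exact: Iseg.
have df x : x \in `[a, a + c] -> is_derive x 1 f (f^`()%classic x).
  by move=> /Ix ?; split; [exact: f_diff|rewrite derive1E].
have df' x : x \in `[a, a + c] -> is_derive x 1 (f^`())%classic (f^`(2)%classic x).
  by move=> /Ix ?; split; [exact: f'_diff|rewrite -derive1E].
rewrite (trapezoid_identity c0 alpha_gt0 df df' f''_L1).
pose w (t : R) := (1 - (1 - t) `^ (alpha + 1) - t `^ (alpha + 1)) / (alpha + 1).
(* Integrability is assumed for this product and not for [h], so [h] is always kept together with
   its weight under the integral. *)
pose wh t := w t * h t.
set A := `|_^`(2)%classic a|; set B := `|_^`(2)%classic b|.
rewrite -[X in _ <= _ * (_ * X)]/(\int[mu]_(t in `[0, 1]) wh t).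
set S := \int[mu]_(t in `[0, 1]) wh t.
have w0 t : t \in `[0, 1] -> 0 <= w t by exact: unit_trapezoid_kernel_ge0.
have wh0 t : t \in `[0, 1] -> 0 <= wh t.
  by move=> t01; rewrite mulr_ge0 ?w0//; apply: h_ge0; exact: J01.
(* At x = a + t c these return t and 1 - t. They have the form p + q x of the affine change of
   variables, with |q| = 1/c, so each integral below equals c S. *)
pose phi1 x := - a / c + c^-1 * x; pose phi2 x := (a + c) / c + - c^-1 * x.
have phi1E t : phi1 (a + t * c) = t by rewrite /phi1; field.
have phi2E t : phi2 (a + t * c) = 1 - t by rewrite /phi2; field.
have ivc0 : 0 < c^-1 by rewrite invr_gt0.
have pre1 : phi1 @^-1` `[0, 1] = `[a, a + c]%classic.
  apply/seteqP; split => x /=.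
    rewrite /phi1 !in_itv/= -(ler_pM2r c0) -[X in _ && X](ler_pM2r c0).
    have -> : (- a / c + c^-1 * x) * c = x - a by field.
    by move=> /andP[? ?]; apply/andP; split; lra.
  by move=> /seg[t t01 ->]; rewrite phi1E.
have pre2 : phi2 @^-1` `[0, 1] = `[a, a + c]%classic.
  apply/seteqP; split => x /=.
    rewrite /phi2 !in_itv/= -(ler_pM2r c0) -[X in _ && X](ler_pM2r c0).
    have -> : ((a + c) / c + - c^-1 * x) * c = a + c - x by field.
    by move=> /andP[? ?]; apply/andP; split; lra.
  move=> /seg[t + ->]; rewrite phi2E !in_itv/= => /andP[? ?].
  by apply/andP; split; lra.
have iV0 : c^-1 != 0 by rewrite invr_eq0.
have NiV0 : - c^-1 != 0 by rewrite oppr_eq0.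
have i1 : mu.-integrable `[a, a + c] (EFin \o (wh \o phi1)).
  by rewrite -pre1; exact: (integrable_affine (- a / c) iV0 (measurable_itv _) h_int).
have i2 : mu.-integrable `[a, a + c] (EFin \o (wh \o phi2)).
  by rewrite -pre2; exact: (integrable_affine ((a + c) / c) NiV0 (measurable_itv _) h_int).
have e1 : \int[mu]_(x in `[a, a + c]) wh (phi1 x) = c * S.
  have := ge0_Rintegral_affine (- a / c) iV0 (measurable_itv _) h_int wh0.
  rewrite -[X in X = _]/S => ->.
  rewrite -[X in _ = _ * (_ * X)]/(Rintegral mu (phi1 @^-1` `[0, 1]) (wh \o phi1)).
  by rewrite pre1 gtr0_norm// mulrA divff// mul1r.
have e2 : \int[mu]_(x in `[a, a + c]) wh (phi2 x) = c * S.
  have := ge0_Rintegral_affine ((a + c) / c) NiV0 (measurable_itv _) h_int wh0.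
  rewrite -[X in X = _]/S => ->.
  rewrite -[X in _ = _ * (_ * X)]/(Rintegral mu (phi2 @^-1` `[0, 1]) (wh \o phi2)).
  by rewrite pre2 normrN gtr0_norm// mulrA divff// mul1r.
have iQ : mu.-integrable `[a, a + c] (EFin \o
    (fun x => trapezoid_kernel a c alpha x * f^`(2)%classic x)).
  by apply: integrable_continuousM => //; exact: continuous_trapezoid_kernel.
apply: le_trans (le_normr_Rintegral _ iQ) _ => //.
have i1' : mu.-integrable `[a, a + c] (EFin \o (fun x => c * B * wh (phi1 x))).
  exact: (integrableZl _ (c * B) i1).
have i2' : mu.-integrable `[a, a + c] (EFin \o (fun x => c * A * wh (phi2 x))).
  exact: (integrableZl _ (c * A) i2).
(* The bound is turned into an integral over [a, a + c], which leaves a pointwise comparison of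
   integrands. *)
have -> : c ^+ 2 * ((A + B) * S) =
    \int[mu]_(x in `[a, a + c]) (c * A * wh (phi2 x) + c * B * wh (phi1 x)).
  by rewrite RintegralD// !RintegralZl// e1 e2; ring.
apply: le_Rintegral => //.
- exact: integrable_norm.
- exact: (integrableD _ i2' i1').
move=> x /seg[t t01 ->].
have t01' : 1 - t \in `[0, 1].
  by move: t01; rewrite !in_itv/= => /andP[? ?]; apply/andP; split; lra.
rewrite phi1E phi2E trapezoid_kernelE// -/(w t) normrM ger0_norm; last first.
  by rewrite mulr_ge0 ?(ltW c0) ?w0.
(* The symmetry w(1 - t) = w(t) gives both values of [h] the same weight, so that the right-hand
   side of preinvexity appears. *)
have -> : c * A * wh (1 - t) + c * B * wh t = c * w t * (h (1 - t) * A + h t * B).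
  rewrite /wh; have -> : w (1 - t) = w t by rewrite /w subKr addrAC.
  by ring.
apply: ler_wpM2l; first by apply: mulr_ge0; [exact: ltW|exact: w0].
exact: (f''_preinvex _ _ _ _ Ia Ib t01 (Iseg _ t01) (esym (pointE t))).
Qed.
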